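(* Let $\kappa>0$ and let $\mathcal K\subset\mathbb R^2$ be a domain whose boundary $\partial\mathcal K=\sigma$ is a $\kappa$-constrained loop. (a) If $\partial\mathcal K=\sigma$ admits a pair of essential terminals, then $\mathcal K$ is not convex. (b) If $\mathcal K$ is convex, then $\partial\mathcal K=\sigma$ admits only inessential terminals.
   Context: Put $r=1/\kappa$. A planar domain is an open connected subset of $\mathbb R^2$. A loop $\sigma:S^1\to\mathbb R^2$ is a homeomorphic image of the circle (so it is simple), of class $C^1$, regular, arc length parametrised, traversed clockwise, with period equal to its length. A loop is $\kappa$-constrained if it is of class piecewise $C^2$ and $\|\sigma''\|\le\kappa$ wherever $\sigma''$ is defined. A loop is identified with its image when convenient. Turning condition: for a $\kappa$-constrained loop $\sigma$ consider a restriction $\sigma:[t_1,t_2]\subset S^1\to\mathbb R^2$, whose endpoints $\sigma(t_1),\sigma(t_2)$ are called terminals. Let $D_1,D_2$ be the disks of radius $r$ with $\sigma(t_1),\sigma(t_2)\in\partial D_1\cap\partial D_2$ (two distinct disks when $0<\|\sigma(t_1)-\sigma(t_2)\|<2r$). The curve is short if $\|\sigma(t_1)-\sigma(t_2)\|\le 2r$ and $\sigma([t_1,t_2])\subset D_1\cap D_2$; it is long if $\|\sigma(t_1)-\sigma(t_2)\|<2r$ and $\sigma([t_1,t_2])$ has a point in $(D_1\cap D_2)^c$; it is simple if $\|\sigma(t_1)-\sigma(t_2)\|\ge 2r$. By definition an arc of a circle of radius $r$ is short, simple but never long. A pair of terminals separates the loop into two complementary curves. Terminals are called essential if they are not terminals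 of a short or a simple curve (i.e. neither of the two complementary curves of the loop is short or simple). Terminals that are not essential are called inessential. *)

(* Defs.v *)
From HB Require Import structures.
From mathcomp Require Import all_boot all_order all_algebra.
From mathcomp Require Import all_classical all_reals all_analysis.

Set Implicit Arguments.
Unset Strict Implicit.
Unset Printing Implicit Defensive.

Import Order.TTheory GRing.Theory Num.Theory.
Import numFieldNormedType.Exports.

Local Open Scope classical_set_scope.
Local Open Scope ring_scope.

Notation plane R := (R * R)%type.

(* The library norm on a product is the sup norm; it induces the right topology
   but lengths and curvature need the Euclidean one. *)
Definition enorm (R : realType) (p : plane R) : R :=
  Num.sqrt (p.1 ^+ 2 + p.2 ^+ 2).

Definition edist (R : realType) (p q : plane R) : R := enorm (p - q).

Definition boundary (R : realType) (A : set (plane R)) : set (plane R) :=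
  closure A `\` interior A.

Definition planar_domain (R : realType) (K : set (plane R)) : Prop :=
  open K /\ connected K.

(* The first conjunct is needed: the component of a point outside the ambient
   set is empty, hence bounded. *)
Definition inside (R : realType) (C : set (plane R)) (p : plane R) : Prop :=
  ~ C p /\ bounded_set (connected_component (~` C) p).

Definition right_normal (R : realType) (v : plane R) : plane R := (v.2, - v.1).

(* The region enclosed by the curve lies on the right of a moving point. *)
Definition clockwise (R : realType) (sigma : R -> plane R) : Prop :=
  forall t : R, \forall h \near 0^'+,
    inside (range sigma) (sigma t + h *: right_normal (derive1 sigma t)).

(* A map on the circle is an L-periodic map on R.  Unit speed gives regularity
   and makes the period L equal to the length. *)
Definition loop (R : realType) (L : R) (sigma : R -> plane R) : Prop :=
  [/\ 0 < L,
      forall t, sigma (t + L) = sigma t,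
      {in `[0, L[ &, injective sigma},
      [/\ forall t, derivable sigma t 1, continuous (derive1 sigma)
        & forall t, enorm (derive1 sigma t) = 1]
    & clockwise sigma].

(* On each closed piece the curve is C^2 up to the end points, i.e. sigma'' on
   the open piece is the restriction of a continuous function. *)
Definition piecewise_C2 (R : realType) (L : R) (sigma : R -> plane R) : Prop :=
  exists (n : nat) (s : nat -> R),
    [/\ s 0%N = 0, s n = L & forall i, (i < n)%N ->
      s i < s i.+1 /\
      exists2 g : R -> plane R, continuous g &
        forall t, s i < t < s i.+1 -> is_derive t 1 (derive1 sigma) (g t)].

Definition constrained_loop (R : realType) (kappa L : R)
    (sigma : R -> plane R) : Prop :=
  [/\ loop L sigma, piecewise_C2 L sigma
    & forall t, derivable (derive1 sigma) t 1 ->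
        enorm (derive1 (derive1 sigma) t) <= kappa].

(* The closed disks of radius r whose bounding circle contains p and q: two of
   them if 0 < edist p q < 2 * r, one if edist p q = 2 * r.  The lens is their
   intersection. *)
Definition lens (R : realType) (r : R) (p q : plane R) : set (plane R) :=
  [set x | forall c, edist p c = r -> edist q c = r -> edist x c <= r].

(* A curve contained in a circle is an arc of it, being connected. *)
Definition circle_arc (R : realType) (r : R) (sigma : R -> plane R)
    (t1 t2 : R) : Prop :=
  exists c, forall t, t1 <= t <= t2 -> edist (sigma t) c = r.

(* Arcs of circles of radius r are short and simple by convention, even when
   they are longer than a half circle. *)
Definition short_curve (R : realType) (r : R) (sigma : R -> plane R)
    (t1 t2 : R) : Prop :=
  (edist (sigma t1) (sigma t2) <= 2 * r /\
   forall t, t1 <= t <= t2 -> lens r (sigma t1) (sigma t2) (sigma t)) \/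
  circle_arc r sigma t1 t2.

Definition simple_curve (R : realType) (r : R) (sigma : R -> plane R)
    (t1 t2 : R) : Prop :=
  2 * r <= edist (sigma t1) (sigma t2) \/ circle_arc r sigma t1 t2.

(* Two distinct points sigma t1, sigma t2 of the loop; the complementary curves
   are the restrictions to [t1, t2] and [t2, t1 + L]. *)
Definition terminals (R : realType) (L t1 t2 : R) : Prop := t1 < t2 < t1 + L.

Definition essential (R : realType) (r L : R) (sigma : R -> plane R)
    (t1 t2 : R) : Prop :=
  [/\ terminals L t1 t2,
      ~ (short_curve r sigma t1 t2 \/ simple_curve r sigma t1 t2)
    & ~ (short_curve r sigma t2 (t1 + L) \/ simple_curve r sigma t2 (t1 + L))].

Definition inessential (R : realType) (r L : R) (sigma : R -> plane R)
    (t1 t2 : R) : Prop :=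
  terminals L t1 t2 /\ ~ essential r L sigma t1 t2.

(* Main.v *)
Require Import Defs.
From HB Require Import structures.
From mathcomp Require Import all_boot all_order all_algebra.
From mathcomp Require Import all_classical all_reals all_analysis.
From mathcomp Require Import ring lra.

Import Order.TTheory GRing.Theory Num.Theory.
Import numFieldNormedType.Exports.

Set Implicit Arguments.
Unset Strict Implicit.
Unset Printing Implicit Defensive.

Local Open Scope classical_set_scope.
Local Open Scope ring_scope.

(** A convex [K] lies to the right of every tangent line of its boundary
    [sigma]: a tangent line cannot meet [K] ([tangent_line_misses_convex]), and
    the orientation selects the side ([convex_right_of_tangent]).  The piecewise
    bound on the second derivative makes the unit tangent [T] Lipschitz with
    constant [kappa] ([constrained_loop_lip]).  These two facts suffice to show
    that, of the two arcs between [p = sigma s] and [q = sigma t] at distance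
    less than [2 r], where [r = kappa^-1], one lies in the lens
    ([short_or_short]); hence no pair of terminals is essential.

    By support, each arc stays on its own side of the chord ([chord_side]), and
    [T] turns by at most a half circle along one of them, say from [p] to [q].
    That arc is then confined to the region cut out by the chord and the tangent
    lines at [p] and [q], which projects onto the chord along the tangent at [p]
    ([projects_onto_chord]).  Take a disk of radius [rho < r] through [p] and
    [q], centred across the chord, and slide it along that tangent as long as
    its upper half circle meets the arc.  If the arc left the disk, there would
    be a last contact away from the end points, at which the arc touches the
    circle of radius [rho] from within; but its curvature, at most [1 / r], is
    too small for that ([escape_disk], [slide_disk]).  So the arc lies in every
    such disk, and letting [rho] tend to [r] puts it in the lens
    ([lens_of_disks]).  The case where the chord is tangent to the curve is
    separate: then one of the two arcs is the chord itself ([flat_arc]). *)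

Local Notation nu := right_normal.

(** * Plane vectors and their scalar product *)

Section EuclideanPlane.
Variable R : realType.
Implicit Types (u v w : plane R) (a b : R).

Definition dot u v : R := u.1 * v.1 + u.2 * v.2.

Lemma dotC u v : dot u v = dot v u.
Proof. by rewrite /dot mulrC [X in _ + X]mulrC. Qed.

Lemma dotDr u v w : dot u (v + w) = dot u v + dot u w.
Proof. by rewrite /dot /=; ring. Qed.

Lemma dotZr a u v : dot u (a *: v) = a * dot u v.
Proof. by rewrite /dot /= -![_ *: _]/(_ * _); ring. Qed.

Lemma dotNr u v : dot u (- v) = - dot u v.
Proof. by rewrite /dot /=; ring. Qed.

Lemma dotBr u v w : dot u (v - w) = dot u v - dot u w.
Proof. by rewrite dotDr dotNr. Qed.

Lemma dotNl u v : dot (- u) v = - dot u v.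
Proof. by rewrite dotC dotNr dotC. Qed.

Lemma dot_ge0 u : 0 <= dot u u.
Proof. by rewrite addr_ge0 // -expr2 sqr_ge0. Qed.

Lemma enorm_sqr u : enorm u ^+ 2 = dot u u.
Proof. by rewrite sqr_sqrtr ?addr_ge0 ?sqr_ge0 // /dot !expr2. Qed.

Lemma enorm_ge0 u : 0 <= enorm u.
Proof. exact: sqrtr_ge0. Qed.

Lemma enorm_le u a : 0 <= a -> (enorm u <= a) = (dot u u <= a ^+ 2).
Proof. by move=> a0; rewrite -enorm_sqr ler_sqr ?nnegrE ?enorm_ge0. Qed.

Lemma dot_eq0 u : dot u u = 0 -> u = 0.
Proof.
move/eqP; rewrite paddr_eq0 -?expr2 ?sqr_ge0 // !sqrf_eq0 =>
  /andP[/eqP h1 /eqP h2].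
by case: u h1 h2 => a b /= -> ->.
Qed.

Lemma dot_gt0 u : u != 0 -> 0 < dot u u.
Proof. by move=> u0; rewrite lt_def dot_ge0 andbT;
  apply: contra_neq u0 => /dot_eq0. Qed.

Lemma dot_nu_nu u v : dot (nu u) (nu v) = dot u v.
Proof. by rewrite /dot /=; ring. Qed.

Lemma dot_nul u v : dot (nu u) v = - dot u (nu v).
Proof. by rewrite /dot /=; ring. Qed.

(** The expansion of [u] and [v] in the orthogonal frame [D, nu D]. *)
Lemma dot_frame D u v :
  dot D D * dot u v = dot D u * dot D v + dot (nu D) u * dot (nu D) v.
Proof. by rewrite /dot /=; ring. Qed.

Lemma dot_nu_self u : dot (nu u) u = 0.
Proof. by rewrite /dot /=; ring. Qed.

Lemma collinearE u w : u != 0 -> dot (nu u) w = 0 ->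
  w = (dot u w / dot u u) *: u.
Proof.
move=> /dot_gt0 u0 nw; apply/eqP; rewrite -subr_eq0; apply/eqP/dot_eq0.
set v := w - _; suff /eqP : dot u u * dot v v = 0.
  by rewrite mulf_eq0 gt_eqF //= => /eqP.
rewrite dot_frame /v [dot u (_ - _)]dotBr [dot (nu u) (_ - _)]dotBr !dotZr nw.
by rewrite dot_nu_self divfK ?gt_eqF // !subrr; ring.
Qed.

Lemma cauchy_schwarz u v : `|dot u v| <= enorm u * enorm v.
Proof.
rewrite -(@ler_pXn2r _ 2) ?nnegrE ?mulr_ge0 ?enorm_ge0 //.
rewrite real_normK ?num_real // exprMn !enorm_sqr dot_frame -expr2 lerDl.
by rewrite -expr2 sqr_ge0.
Qed.

Lemma continuous_dot u : continuous (dot u).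
Proof.
move=> v; apply: cvgD; apply: cvgM; try exact: cvg_cst.
  exact: cvg_fst.
exact: cvg_snd.
Qed.

Lemma is_derive_dot u (f : R -> plane R) (t : R) (df : plane R) :
  is_derive t 1 f df -> is_derive t 1 (fun s => dot u (f s)) (dot u df).
Proof.
move=> [fd fE].
have cf : h^-1 *: (dot u (f (h *: 1 + t)) - dot u (f t)) @[h --> 0^'] --> dot u
  df.
  have -> : (fun h : R => h^-1 *: (dot u (f (h *: 1 + t)) - dot u (f t))) =
            dot u \o (fun h : R => h^-1 *: (f (h *: 1 + t) - f t)).
    by apply/funext => h /=; rewrite dotZr dotBr.
  apply: continuous_cvg; first exact: continuous_dot.
  by rewrite -fE; exact: fd.
apply: DeriveDef; first by apply/cvg_ex; exists (dot u df).
exact/cvg_lim.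
Qed.

End EuclideanPlane.

(** * Disks through the two ends of a chord *)

Section LensGeometry.
Variable R : realType.
Implicit Types (u v w z a b p q x D : plane R).

(** The triangle cut out by the chord [D] and the tangent lines at its two ends
    projects onto the chord along the first tangent, as soon as the two
    tangents meet on that side of the chord. *)
Lemma projects_onto_chord D a b z : dot (nu b) D < 0 ->
  0 <= dot (nu a) D -> 0 <= dot (nu a) b ->
  dot (nu D) z <= 0 -> 0 <= dot (nu b) (z - D) ->
  dot (nu a) z <= dot (nu a) D.
Proof.
move=> bD aD ab zD zb; rewrite -subr_ge0 -(@pmulr_lge0 _ (- dot (nu b) D))
  ?oppr_gt0 //.
have -> : (dot (nu a) D - dot (nu a) z) * - dot (nu b) D =
    dot (nu a) D * dot (nu b) (z - D) + - dot (nu D) z * dot (nu a) b.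
  by rewrite /dot /=; ring.
by rewrite addr_ge0 // mulr_ge0 // oppr_ge0.
Qed.

(** With [D = q - p], the centre of the circle through [p] and [q] of squared
    radius [dot D D * (4^-1 + h ^+ 2)] which lies to the right of the chord when
    [0 < h]. *)
Definition chord_center p q (h : R) : plane R :=
  2^-1 *: (p + q) + h *: nu (q - p).

Lemma chord_in_disk p q (h l : R) (D := q - p) (c := chord_center p q h) :
  0 <= l <= 1 ->
  dot (p + l *: D - c) (p + l *: D - c) <= dot D D * (4^-1 + h ^+ 2).
Proof.
move=> /andP[l0 l1]; rewrite -subr_ge0.
have -> : dot D D * (4^-1 + h ^+ 2) - dot (p + l *: D - c) (p + l *: D - c) =
    dot D D * (l * (1 - l)).
  by rewrite /c /D /chord_center /dot /= -![_ *: _]/(_ * _); field.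
by rewrite !mulr_ge0 ?dot_ge0 // subr_ge0.
Qed.

(** On the left of the chord the lens coincides with its disk centred on the
    right, which is the limit of the disks of radius below [r] through [p] and
    [q]. *)
Lemma lens_of_disks (r : R) p q x (D := q - p) :
  0 < r -> p != q -> dot D D < (2 * r) ^+ 2 -> dot (nu D) (x - p) <= 0 ->
  (forall h, 0 <= h -> dot D D * (4^-1 + h ^+ 2) < r ^+ 2 ->
     dot (x - chord_center p q h) (x - chord_center p q h)
       <= dot D D * (4^-1 + h ^+ 2)) ->
  lens r p q x.
Proof.
move=> r0 pq Dr side disks c; rewrite /Defs.edist => pc qc.
rewrite enorm_le ?(ltW r0) //.
have D_neq0 : D != 0 by rewrite subr_eq0 eq_sym.
have D0 : 0 < dot D D by exact: dot_gt0.
pose m := 2^-1 *: (p + q); pose h := dot (nu D) (c - m) / dot D D.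
have pc2 : dot (p - c) (p - c) = r ^+ 2 by rewrite -pc enorm_sqr.
have qc2 : dot (q - c) (q - c) = r ^+ 2 by rewrite -qc enorm_sqr.
have cE : c = m + h *: nu D.
  have Dc : dot D (c - m) = 0.
    have : dot (p - c) (p - c) - dot (q - c) (q - c) = 2 * dot D (c - m).
      by rewrite /m /D /dot /= -![_ *: _]/(_ * _); field.
    by rewrite pc2 qc2 subrr; lra.
  have nD_neq0 : nu D != 0.
    by apply: contraTneq D0 => nD0; rewrite -dot_nu_nu nD0 /dot /= !mulr0 addr0
      ltxx.
  apply/eqP; rewrite addrC -subr_eq; apply/eqP.
  rewrite [LHS](collinearE nD_neq0) ?dot_nu_nu //.
  by rewrite dot_nul dot_nu_nu Dc oppr0.
have r2 : r ^+ 2 = dot D D * (4^-1 + `|h| ^+ 2).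
  rewrite real_normK ?num_real // -pc2 cE /m /D /dot /= -![_ *: _]/(_ * _).
  by field.
pose w := x - m; pose W := dot (nu D) w.
have W0 : W <= 0.
  rewrite (_ : W = dot (nu D) (x - p)) //.
  by rewrite /W /w /m /D /dot /= -![_ *: _]/(_ * _); field.
have expand (s : R) : dot (x - (m + s *: nu D)) (x - (m + s *: nu D)) =
    dot w w - 2 * s * W + dot D D * s ^+ 2.
  by rewrite /W /w /dot /= -![_ *: _]/(_ * _); ring.
have h0 : 0 < `|h|.
  rewrite normr_gt0; apply: contraTneq Dr => h0.
  by rewrite -leNgt exprMn r2 h0 normr0; lra.
(* The condition on the disk at height [s] is affine in [s], so it passes to
   the limit [s = `|h|] of the heights for which it is known. *)
have key : dot w w - 2 * `|h| * W <= dot D D / 4.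
  rewrite leNgt; apply/negP => viol.
  pose gap := dot w w - 2 * `|h| * W - dot D D / 4.
  have gap0 : 0 < gap by rewrite subr_gt0.
  pose e := Num.min `|h| (gap / (- 2 * W + 1)).
  have W1 : 0 < - 2 * W + 1 by lra.
  have e0 : 0 < e by rewrite lt_min h0 divr_gt0.
  have [e1 e2] : e <= `|h| /\ e <= gap / (- 2 * W + 1).
    by split; rewrite ge_min lexx ?orbT.
  have := disks (`|h| - e); rewrite subr_ge0 e1 => /(_ isT).
  rewrite r2 ltr_pM2l // ltrD2l ltr_sqr ?nnegrE ?subr_ge0 // gtrBl e0 =>
    /(_ isT).
  rewrite /chord_center -/D -/m expand [leRHS]mulrDr.
  rewrite ler_pdivlMr // in e2.
  have : - 2 * W * e < gap by lra.
  rewrite /gap; lra.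
rewrite cE expand r2 [leRHS]mulrDr real_normK ?num_real //.
have hW : - (h * W) <= - (`|h| * W) by rewrite lerN2 ler_wnM2r // ler_norm.
lra.
Qed.

End LensGeometry.

(** * Curves of bounded curvature against disks *)

Lemma MVT_between (R : realType) (f df : R -> R) (s t : R) :
  (forall x : R, is_derive x (1 : R) f (df x)) -> s != t ->
  exists x : R, [/\ `|x - s| < `|t - s|, `|t - x| < `|t - s|,
    0 < (x - s) * (t - s) & f t - f s = df x * (t - s)].
Proof.
move=> fd st.
have fc a b : {within `[a, b], continuous f}.
  by apply: derivable_within_continuous => x _; case: (fd x).
case: (ltgtP s t) st => // [lt_st|lt_ts] _.
- have [x] := MVT lt_st (fun x _ => fd x) (fc _ _).
  rewrite in_itv /= => /andP[sx xt] e; exists x.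
  rewrite !gtr0_norm ?subr_gt0 // mulr_gt0 ?subr_gt0 //; split => //; lra.
- have [x] := MVT lt_ts (fun x _ => fd x) (fc _ _).
  rewrite in_itv /= => /andP[tx xs] e; exists x.
  rewrite ![`|_ - s|]ltr0_norm ?subr_lt0 // ltr0_norm ?subr_lt0 //.
  rewrite nmulr_lgt0 ?subr_lt0 //; split => //; [lra|lra|].
  by rewrite -[LHS]opprB e -mulrN opprB.
Qed.

Lemma is_derive_sqr_sum (R : realType) (f g : R -> R) (x df dg : R) :
  is_derive x (1 : R) f df -> is_derive x (1 : R) g dg ->
  is_derive x (1 : R) (fun s => f s * f s + g s * g s)
    (2 * (f x * df + g x * dg)).
Proof.
move=> hf hg; have H := is_deriveD (is_deriveM hf hf) (is_deriveM hg hg).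
suff -> : 2 * (f x * df + g x * dg) =
  f x *: df + f x *: df + (g x *: dg + g x *: dg) by [].
by rewrite -![_ *: _]/(_ * _); ring.
Qed.

(** The derivative [T] of [sigma] is the unit tangent; the curvature bound
    [kappa] enters as a Lipschitz constant of [T], which makes sense also
    where [T] has no derivative. *)
Section LipschitzTangent.
Variables (R : realType) (kappa : R) (sigma T : R -> plane R).
Hypothesis kappa_gt0 : 0 < kappa.
Hypothesis sigmaD : forall t : R, is_derive t (1 : R) sigma (T t).
Hypothesis T_unit : forall t, dot (T t) (T t) = 1.
Hypothesis T_lip :
  forall e s t, `|dot e (T t - T s)| <= enorm e * kappa * `|t - s|.

Lemma is_derive_dot_sub e c (t : R) :
  is_derive t (1 : R) (fun s => dot e (sigma s - c)) (dot e (T t)).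
Proof.
have -> : (fun s => dot e (sigma s - c)) =
          (fun s => dot e (sigma s)) - cst (dot e c).
  by apply/funext => s; rewrite dotBr.
rewrite -[X in is_derive _ _ _ X]subr0.
by apply: is_deriveB; exact: is_derive_dot.
Qed.

Lemma continuous_dot_sub e c : continuous (fun s => dot e (sigma s - c)).
Proof.
move=> t; apply: differentiable_continuous; apply/derivable1_diffP.
by case: (is_derive_dot_sub e c t).
Qed.

Lemma is_derive_sqr_dist c (t : R) :
  is_derive t (1 : R) (fun s => dot (sigma s - c) (sigma s - c))
                (2 * dot (sigma t - c) (T t)).
Proof.
have H := is_derive_sqr_sum (is_derive_dot_sub (1, 0) c t)
                           (is_derive_dot_sub (0, 1) c t).
have -> : 2 * dot (sigma t - c) (T t) =
    2 * (dot (1, 0) (sigma t - c) * dot (1, 0) (T t) +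
         dot (0, 1) (sigma t - c) * dot (0, 1) (T t)).
  by rewrite /dot /=; ring.
rewrite (_ : (fun s => _) = (fun s =>
    dot (1, 0) (sigma s - c) * dot (1, 0) (sigma s - c) +
    dot (0, 1) (sigma s - c) * dot (0, 1) (sigma s - c))) //.
by apply/funext => s; rewrite /dot /=; ring.
Qed.

Lemma dot_sub_mvt e s t : s != t ->
  exists x, [/\ `|x - s| < `|t - s|, `|t - x| < `|t - s|, 0 < (x - s) * (t - s)
    & dot e (sigma t - sigma s) = dot e (T x) * (t - s)].
Proof.
move=> st; have [x [h1 h2 h3 h4]] := MVT_between (is_derive_dot_sub e 0) st.
by exists x; split => //; rewrite -h4 !subr0 dotBr.
Qed.

Lemma enorm_T t : enorm (T t) = 1.
Proof. by rewrite /enorm !expr2 -[_ + _]/(dot _ _) T_unit sqrtr1. Qed.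

Lemma dot_T_le e t : `|dot e (T t)| <= enorm e.
Proof. by rewrite -[leRHS]mulr1 -(enorm_T t) cauchy_schwarz. Qed.

(** A curve of curvature at most [kappa] that is tangent to a circle of radius
    [rho < kappa^-1] bends less than the circle, so it leaves the disk on both
    sides of the point of contact. *)
Lemma escape_disk c rho t0 : 0 < rho -> rho * kappa < 1 ->
  dot (sigma t0 - c) (sigma t0 - c) = rho ^+ 2 ->
  dot (sigma t0 - c) (T t0) = 0 ->
  exists2 eps, 0 < eps & forall t, t != t0 -> `|t - t0| < eps ->
    rho ^+ 2 < dot (sigma t - c) (sigma t - c).
Proof.
move=> rho0 rk e0 o0; exists ((1 - rho * kappa) / kappa).
  by rewrite divr_gt0 // subr_gt0.
move=> t tt0 te.
have t0t : t0 != t by rewrite eq_sym.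
have [x [h1 h2 h3 h4]] := MVT_between (is_derive_sqr_dist c) t0t.
rewrite -subr_gt0 -e0 h4 -mulrA pmulr_rgt0 //.
suff hx : 0 < dot (sigma x - c) (T x) * (x - t0).
  have xt0 : x - t0 != 0 by apply: contraTneq h3 => ->; rewrite mul0r ltxx.
  rewrite -(@pmulr_lgt0 _ ((x - t0) ^+ 2)) ?exprn_even_gt0 //.
  have := mulr_gt0 hx h3; congr (_ < _); ring.
set w := sigma t0 - c in e0 o0 *.
have xt0 : t0 != x.
  by apply: contraTneq h3 => ->; rewrite subrr mul0r ltxx.
have [y [k1 k2 k3 k4]] := dot_sub_mvt (T x) xt0.
have -> : dot (sigma x - c) (T x) =
    dot w (T x - T t0) + (1 + dot (T x) (T y - T x)) * (x - t0).
  have -> : 1 + dot (T x) (T y - T x) = dot (T x) (T y).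
    by rewrite dotBr T_unit; ring.
  by rewrite -k4 dotBr o0 /w /dot /=; ring.
have ew : enorm w = rho.
  by rewrite /enorm !expr2 -[_ + _]/(dot w w) e0 sqrtr_sqr gtr0_norm.
have := T_lip w t0 x; rewrite ew.
have := T_lip (T x) x y; rewrite enorm_T mul1r.
move: (dot w _) (dot (T x) _) => A B hB hA.
have ha : kappa * `|x - t0| < 1 - rho * kappa.
  by rewrite mulrC -ltr_pdivlMr // (lt_trans h1).
have hB' : `|B| <= kappa * `|x - t0|.
  by rewrite (le_trans hB) // ler_pM2l // distrC ltW.
rewrite mulrDl -mulrA.
have hx : 0 < `|x - t0| by rewrite normr_gt0 subr_eq0 eq_sym.
have -> : (x - t0) * (x - t0) = `|x - t0| ^+ 2 by rewrite real_normK ?num_real.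
have hA' : - (rho * kappa * `|x - t0| ^+ 2) <= A * (x - t0).
  rewrite lerNl (le_trans (ler_norm _)) // normrN normrM expr2 mulrA.
  by rewrite ler_wpM2r.
have hB2 : - (kappa * `|x - t0|) <= B.
  by rewrite lerNl (le_trans _ hB') // -normrN ler_norm.
have : rho * kappa * `|x - t0| ^+ 2 < (1 + B) * `|x - t0| ^+ 2.
  by rewrite ltr_pM2r ?exprn_gt0 //; lra.
lra.
Qed.

(** Seen along [v], the arc stays below the upper half of the circle of radius
    [rho < kappa^-1] around [c].  Otherwise push the disk along [v] to the last
    position at which its upper half circle still meets the arc: there the arc
    touches the circle from within, and [escape_disk] forbids that. *)
Lemma slide_disk c v rho t1 t2 : 0 < rho -> rho * kappa < 1 -> dot v v = 1 ->
  (forall t, t1 <= t <= t2 -> `|dot (nu v) (sigma t - c)| <= rho) ->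
  dot (sigma t1 - c) (sigma t1 - c) <= rho ^+ 2 ->
  dot (sigma t2 - c) (sigma t2 - c) <= rho ^+ 2 ->
  forall t, t1 <= t <= t2 ->
    dot v (sigma t - c) <= Num.sqrt (rho ^+ 2 - dot (nu v) (sigma t - c) ^+ 2).
Proof.
move=> rho0 rk v1 strip end1 end2 t0 /andP[t10 t02].
have frame u : dot u u = dot v u ^+ 2 + dot (nu v) u ^+ 2.
  by rewrite -[LHS]mul1r -v1 dot_frame !expr2.
set rt := fun t => Num.sqrt (rho ^+ 2 - dot (nu v) (sigma t - c) ^+ 2).
pose h t := dot v (sigma t - c) - rt t.
have hc : {within `[t1, t2], continuous h}.
  apply: continuous_subspaceT => t; apply: cvgB;
    first exact: continuous_dot_sub.
  apply: continuous_cvg; first exact: sqrt_continuous.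
  apply: cvgB; first exact: cvg_cst.
  have -> : (fun x => dot (nu v) (sigma x - c) ^+ 2) =
    (fun x => dot (nu v) (sigma x - c)) * (fun x => dot (nu v) (sigma x - c)).
    by apply/funext => x; rewrite expr2.
  by rewrite expr2; apply: cvgM; exact: continuous_dot_sub.
have [tm] := EVT_max (le_trans t10 t02) hc.
rewrite in_itv /= => /andP[t1m tm2] tm_max.
have h_end t : dot (sigma t - c) (sigma t - c) <= rho ^+ 2 -> h t <= 0.
  move=> ht; rewrite /h subr_le0 (le_trans (ler_norm _)) // -sqrtr_sqr.
  by rewrite ler_wsqrtr // lerBrDr -frame.
case: (lerP (h tm) 0) => [hm|hm].
  by rewrite -subr_le0 (le_trans _ hm) // (tm_max t0) // in_itv /= t10.
have {}t1m : t1 < tm.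
  rewrite lt_neqAle t1m andbT; apply: contraTneq hm => <-; rewrite -leNgt;
    exact: h_end.
have {}tm2 : tm < t2.
  rewrite lt_neqAle tm2 andbT; apply: contraTneq hm => ->; rewrite -leNgt;
    exact: h_end.
(* [c'] is the centre of the pushed disk. *)
set H := h tm in tm_max hm.
pose c' := c + H *: v.
have c'E t : sigma t - c' = (sigma t - c) - H *: v by rewrite /c' opprD addrA.
have c'v t : dot v (sigma t - c') = dot v (sigma t - c) - H.
  by rewrite c'E [LHS]dotBr dotZr v1 mulr1.
have c'n t : dot (nu v) (sigma t - c') = dot (nu v) (sigma t - c).
  rewrite c'E [LHS]dotBr dotZr (_ : dot (nu v) v = 0) ?mulr0 ?subr0 //.
  by rewrite /dot /=; ring.
have sq_le t : t1 <= t <= t2 -> dot (nu v) (sigma t - c) ^+ 2 <= rho ^+ 2.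
  move=> ht; rewrite -[X in X <= _]real_normK ?num_real // ler_sqr ?nnegrE
    ?strip //.
  exact: ltW.
have itm : t1 <= tm <= t2 by rewrite !ltW.
have below t : t1 <= t <= t2 -> 0 <= dot v (sigma t - c') ->
    dot (sigma t - c') (sigma t - c') <= rho ^+ 2.
  move=> ht h0; rewrite frame c'n -lerBrDr -[leRHS]sqr_sqrtr ?subr_ge0 ?sq_le
    //.
  rewrite ler_sqr ?nnegrE ?sqrtr_ge0 // c'v.
  have := tm_max t; rewrite in_itv /= => /(_ ht); rewrite /h /rt; lra.
have a_eq : dot v (sigma tm - c') = rt tm by rewrite c'v /H /h; ring.
have contact : dot (sigma tm - c') (sigma tm - c') = rho ^+ 2.
  by rewrite frame c'n a_eq sqr_sqrtr ?subrK // subr_ge0 sq_le.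
have near_tm t : `|t - tm| <= tm - t1 -> `|t - tm| <= t2 - tm -> t1 <= t <= t2.
  rewrite !ler_norml => /andP[? ?] /andP[? ?]; lra.
have rt0 : 0 <= rt tm by exact: sqrtr_ge0.
have ev : enorm v = 1 by rewrite /enorm !expr2 -[_ + _]/(dot v v) v1 sqrtr1.
have c'D t : sigma t - c' = (sigma tm - c') + (sigma t - sigma tm).
  by rewrite [RHS]addrC addrA subrK.
(* If the contact is not on the horizontal diameter, a neighbourhood of it in
   the arc is in the disk.  If it is, the arc runs along [v] there and only its
   upward half is known to be in the disk. *)
have := rt0; rewrite le_eqVlt => /predU1P[a0|a0]; last first.
  pose d := Num.min (rt tm) (Num.min (tm - t1) (t2 - tm)).
  have d0 : 0 < d by rewrite !lt_min a0 !subr_gt0 t1m.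
  have in_disk t : `|t - tm| < d ->
      dot (sigma t - c') (sigma t - c') <= rho ^+ 2.
    rewrite !lt_min => /and3P[d1 d2 d3]; apply: below;
      first by rewrite near_tm // ltW.
    have [->|ttm] := eqVneq t tm; first by rewrite a_eq.
    rewrite eq_sym in ttm; have [x [_ _ _ hx]] := dot_sub_mvt v ttm.
    rewrite c'D dotDr a_eq hx.
    have := dot_T_le v x; rewrite ev.
    move=> hT; have : `|dot v (T x) * (t - tm)| <= `|t - tm|.
      by rewrite normrM ler_piMl.
    rewrite ler_norml => /andP[? _]; lra.
  have orth : dot (sigma tm - c') (T tm) = 0.
    have D0 : is_derive tm (1 : R)
        (fun s => dot (sigma s - c') (sigma s - c')) 0.
      apply: (@derive1_at_max _ _ (tm - d) (tm + d)).
      - lra.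
      - by move=> t _; case: (is_derive_sqr_dist c' t).
      - by rewrite in_itv /= ; apply/andP; split; lra.
      - move=> t; rewrite in_itv /= => ht; rewrite contact in_disk //.
        by rewrite ltr_distl.
    have := is_derive_sqr_dist c' tm; case=> _; case: D0 => _ -> /eqP.
    by rewrite eq_sym mulf_eq0 pnatr_eq0 /= => /eqP.
  have [eps eps0 esc] := escape_disk rho0 rk contact orth.
  pose e := Num.min d eps / 2.
  have e0 : 0 < e by rewrite divr_gt0 // lt_min d0.
  have [ed ee] : e < d /\ e < eps.
    have : Num.min d eps <= d /\ Num.min d eps <= eps.
      by split; rewrite ge_min lexx ?orbT.
    by rewrite /e in e0 *; lra.
  have te : tm + e - tm = e by ring.
  have := in_disk (tm + e); rewrite te gtr0_norm // leNgt => /(_ ed) /negP;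
    case.
  by apply: esc; [rewrite -subr_eq0 te gt_eqF|rewrite te gtr0_norm].
have b_eq : dot (nu v) (sigma tm - c) ^+ 2 = rho ^+ 2.
  by rewrite -contact frame c'n a_eq -a0 expr0n /= add0r.
have b'0 : dot (nu v) (T tm) = 0.
  pose b s := dot (nu v) (sigma s - c).
  have bD t : is_derive (t : R) (1 : R) b (dot (nu v) (T t)).
    exact: is_derive_dot_sub.
  have bbD t := is_derive_sqr_sum (bD t) (bD t).
  have D0 : is_derive tm (1 : R) (fun s => b s * b s + b s * b s) 0.
    apply: (@derive1_at_max _ _ t1 t2).
    - lra.
    - by move=> t _; case: (bbD t).
    - by rewrite in_itv /= t1m.
    - move=> t; rewrite in_itv /= => /andP[ht1 ht2].
      have := sq_le t; rewrite (ltW ht1) (ltW ht2) => /(_ isT);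
        rewrite -b_eq !expr2 => hb.
      by have := lerD hb hb.
  have : b tm * dot (nu v) (T tm) = 0.
    by case: (bbD tm) => _; case: D0 => _ ->; lra.
  move=> /eqP; rewrite mulf_eq0 => /orP[/eqP b0|/eqP //].
  by move: b_eq; rewrite [dot _ _]b0 expr0n => /esym/eqP;
    rewrite expf_eq0 gt_eqF.
have orth : dot (sigma tm - c') (T tm) = 0.
  by rewrite -[LHS]mul1r -v1 dot_frame b'0 a_eq -a0 mul0r mulr0 addr0.
have [eps eps0 esc] := escape_disk rho0 rk contact orth.
set e := dot v (T tm).
have e1 : e * e = 1 by rewrite -(T_unit tm) frame b'0 expr0n /= addr0 expr2.
have ne : `|e| = 1.
  by apply/eqP; rewrite -(@pexpr_eq1 _ _ 2) // real_normK ?num_real // expr2 e1.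
pose d := Num.min (Num.min eps kappa^-1) (Num.min (tm - t1) (t2 - tm)).
have d0 : 0 < d by rewrite !lt_min eps0 invr_gt0 kappa_gt0 !subr_gt0 t1m.
have [d1 d2 d3 d4] : [/\ d <= eps, d <= kappa^-1, d <= tm - t1 & d <= t2 - tm].
  by split; rewrite /d !ge_min !lexx ?orbT.
have te : tm + e * (d / 2) - tm = e * (d / 2) by ring.
have nt : `|e * (d / 2)| = d / 2.
  by rewrite normrM ne mul1r gtr0_norm // divr_gt0.
set t := tm + e * (d / 2) in te.
have ttm : t != tm by rewrite -subr_eq0 te -normr_gt0 nt divr_gt0.
have /(esc t ttm) : `|t - tm| < eps by rewrite te nt; lra.
rewrite ltNge => /negP; case.
apply: below; first by rewrite near_tm // te nt; lra.
rewrite eq_sym in ttm; have [x [xtm _ _ hx]] := dot_sub_mvt v ttm.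
rewrite c'D dotDr a_eq -a0 add0r hx te.
have := T_lip v tm x; rewrite ev mul1r dotBr -/e.
rewrite te nt in xtm => hB.
have kd : kappa * `|x - tm| <= 1 by rewrite mulrC -ler_pdivlMr // div1r; lra.
have hE : `|dot v (T x) * e - 1| <= 1.
  by rewrite -[X in _ - X]e1 -mulrBl normrM ne mulr1 (le_trans hB).
rewrite mulrA mulr_ge0 //; last by lra.
by move: hE; rewrite ler_norml; lra.
Qed.
End LipschitzTangent.

(** * Closed curves to the right of which lies a convex region *)

(** [support] and [support_k0] retain of the convex region only that the closed
    curve is on the right of each of its tangent lines, and that some point
    [k0] is so strictly. *)
Section SupportedCurve.
Variables (R : realType) (kappa L : R) (sigma T : R -> plane R) (k0 : plane R).
Hypothesis kappa_gt0 : 0 < kappa.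
Hypothesis sigmaD : forall t : R, is_derive t (1 : R) sigma (T t).
Hypothesis T_unit : forall t, dot (T t) (T t) = 1.
Hypothesis T_lip :
  forall e s t, `|dot e (T t - T s)| <= enorm e * kappa * `|t - s|.
Hypothesis sigma_per : forall t, sigma (t + L) = sigma t.
Hypothesis T_per : forall t, T (t + L) = T t.
Hypothesis sigma_inj : forall s t : R, s < t < s + L -> sigma s != sigma t.

Hypothesis support : forall s t, 0 <= dot (nu (T s)) (sigma t - sigma s).
Hypothesis support_k0 : forall t, 0 < dot (nu (T t)) (k0 - sigma t).

Lemma T_neq0 t : T t != 0.
Proof.
apply: contra_eq_neq (T_unit t) => ->.
by rewrite /dot /= !mulr0 addr0 eq_sym oner_neq0.
Qed.

Lemma dot_T_at_min e c a b m : a < m < b ->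
  (forall t, a < t < b -> dot e (sigma m - c) <= dot e (sigma t - c)) ->
  dot e (T m) = 0.
Proof.
move=> /andP[am mb] min_m.
have [_ <-] := is_derive_dot_sub sigmaD e c m.
suff [_ ->] : is_derive m (1 : R) (fun s => dot e (sigma s - c)) 0 by [].
apply: (@derive1_at_min _ _ a b).
- by rewrite ltW // (lt_trans am).
- by move=> t _; case: (is_derive_dot_sub sigmaD e c t).
- by rewrite in_itv /= am.
- by move=> t; rewrite in_itv /=; exact: min_m.
Qed.

(** A tangent line that meets the curve again is tangent to it there; the
    tangents agree because [k0] is to the right of both. *)
Lemma same_tangent s t : dot (nu (T s)) (sigma t - sigma s) = 0 -> T t = T s.
Proof.
move=> st0.
have nTt : dot (nu (T s)) (T t) = 0.
  apply: (@dot_T_at_min _ (sigma s) (t - 1) (t + 1)); first by lra.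
  by move=> x _; rewrite st0 support.
set e := dot (T s) (T t).
have Tt : T t = e *: T s.
  by rewrite [LHS](collinearE (T_neq0 s)) // T_unit divr1.
have e2 : e ^+ 2 = 1.
  by rewrite -(T_unit t) {2}Tt dotZr dotC expr2.
move: e2 => /eqP; rewrite sqrf_eq1 => /orP[] /eqP e1;
  first by rewrite Tt e1 scale1r.
have := support_k0 t; have := support_k0 s.
have -> : dot (nu (T t)) (k0 - sigma t) =
    - dot (nu (T s)) (k0 - sigma s) + dot (nu (T s)) (sigma t - sigma s).
  by rewrite Tt e1 scaleN1r /dot /=; ring.
by rewrite st0 addr0 => h1 h2; exfalso; lra.
Qed.

(** If the arc from [s] to [t] crossed its chord, the curve would have three
    points on one line.  The curve lies on one side of the tangent at the middle
    one, so that tangent is the line itself, against the hypothesis on [s]. *)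
Lemma chord_side s u t : s < t < s + L -> s <= u <= t ->
  0 < dot (nu (T s)) (sigma t - sigma s) ->
  dot (nu (sigma t - sigma s)) (sigma u - sigma s) <= 0.
Proof.
move=> /andP[st tL] /andP[su ut] S0; rewrite leNgt; apply/negP => fu0.
set D := sigma t - sigma s in S0 fu0.
pose f x := dot (nu D) (sigma x - sigma s).
have f's : dot (nu D) (T s) < 0 by rewrite dot_nul dotC oppr_lt0.
have {}su : s < u.
  rewrite lt_neqAle su andbT; apply: contraTneq fu0 => <-.
  by rewrite subrr /dot /= !mulr0 addr0 ltxx.
(* The arc starts off to the other side of the chord. *)
have [y [sy yu fy]] : exists y, [/\ s < y, y <= u & f y < 0].
  pose M := enorm (nu D) * kappa.
  have M0 : 0 <= M by rewrite mulr_ge0 ?enorm_ge0 // ltW.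
  pose d := Num.min (u - s) (- dot (nu D) (T s) / (M + 1)).
  have d0 : 0 < d by rewrite lt_min subr_gt0 su divr_gt0 ?oppr_gt0 ?ltr_wpDl.
  have [d1 d2] : d <= u - s /\ d <= - dot (nu D) (T s) / (M + 1).
    by split; rewrite ge_min lexx ?orbT.
  exists (s + d); split; [by rewrite ltrDl|by lra|].
  have sd : s + d - s = d by ring.
  have [|x [xs _ _]] := @dot_sub_mvt _ _ _ sigmaD (nu D) s (s + d).
    by rewrite -subr_eq0 opprD addrA subrr add0r oppr_eq0 gt_eqF.
  rewrite /f sd => ->; rewrite pmulr_llt0 //.
  move: xs; rewrite sd (gtr0_norm d0) => xd.
  have := T_lip (nu D) s x; rewrite -/M dotBr ler_norml => /andP[_ h].
  have hM : M * `|x - s| <= M * d by rewrite ler_wpM2l // ltW.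
  move: d2; rewrite ler_pdivlMr ?ltr_wpDl //; lra.
have [x] : exists2 x, x \in `[y, u] & f x = 0.
  apply: IVT => //.
    by apply: continuous_subspaceT; exact: continuous_dot_sub.
  by rewrite ge_min le_max (ltW fy) (ltW fu0) orbT.
rewrite in_itv /= => /andP[yx xu] fx.
have sx : s < x by rewrite (lt_le_trans sy).
have {}xu : x < u.
  by rewrite lt_neqAle xu andbT; apply: contraTneq fu0 => <-;
    rewrite -/(f x) fx ltxx.
have xt : x < t by rewrite (lt_le_trans xu).
have D_neq0 : D != 0.
  by apply: contraTneq S0 => ->; rewrite /dot /= !mulr0 addr0 ltxx.
(* So it crosses the chord line at a third point. *)
pose lam := dot D (sigma x - sigma s) / dot D D.
have xE : sigma x - sigma s = lam *: D by exact: collinearE.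
have lam0 : 0 <= lam.
  by have := support s x; rewrite xE dotZr pmulr_lge0.
have lam_neq0 : lam != 0.
  have : sigma s != sigma x by rewrite sigma_inj // sx (lt_trans xt).
  by apply: contra => /eqP l0; rewrite eq_sym -subr_eq0 xE l0 scale0r.
have xEt : sigma x - sigma t = (lam - 1) *: D.
  by rewrite scalerBl scale1r -xE /D opprB addrA subrK.
have lam_neq1 : lam != 1.
  have : sigma x != sigma t by rewrite sigma_inj // xt (lt_trans tL) // ltrD2r.
  by apply: contra => /eqP l1; rewrite -subr_eq0 xEt l1 subrr scale0r.
have Dts : sigma s - sigma t = - D by rewrite opprB.
have tS : dot (nu (T t)) D < 0.
  rewrite lt_neqAle; apply/andP; split; last first.
    by have := support t s; rewrite Dts dotNr oppr_ge0.
  apply: contraTneq S0 => t0.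
  have ts0 : dot (nu (T t)) (sigma s - sigma t) = 0.
    by rewrite Dts dotNr t0 oppr0.
  by rewrite (same_tangent ts0) t0 ltxx.
(* By support at its ends, the third point lies strictly within the chord. *)
have lam1 : lam < 1.
  rewrite lt_neqAle lam_neq1 /=.
  by have := support t x; rewrite xEt dotZr nmulr_lge0 // subr_le0.
have x0 : dot (nu (T x)) (sigma s - sigma x) = 0.
  have := support x s; have := support x t.
  rewrite -[sigma s - _]opprB -[sigma t - _]opprB xE xEt !dotNr !dotZr.
  rewrite -mulNr opprB pmulr_rge0 ?subr_gt0 // oppr_ge0 pmulr_rle0 ?lt_def
    ?lam_neq0 //.
  move=> h1 h2; apply/eqP; rewrite oppr_eq0 mulf_eq0 (negPf lam_neq0) /=.
  by rewrite eq_le h2.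
have := support x s; move: S0; rewrite (same_tangent x0).
move: x0; rewrite -[sigma s - _]opprB xE dotNr dotZr => /eqP.
by rewrite oppr_eq0 mulf_eq0 (negPf lam_neq0) /= => /eqP ->; rewrite ltxx.
Qed.

(** When the chord is tangent to the curve at [s], the arc is the chord: a point
    of the arc off that line would, by [chord_side], have [sigma t] on the wrong
    side of its own chord to [sigma s]. *)
Lemma flat_arc s t d : s < t < s + L -> 0 < d -> sigma t - sigma s = d *: T s ->
  forall u, s <= u <= t -> dot (nu (T s)) (sigma u - sigma s) = 0 /\
    0 <= dot (T s) (sigma u - sigma s) <= d.
Proof.
move=> stL d0 tE; have /andP[st tL] := stL.
have nTT := dot_nu_self (T s).
have flat u : s <= u <= t -> dot (nu (T s)) (sigma u - sigma s) = 0.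
  move=> /andP[]; rewrite le_eqVlt => /predU1P[<- _|su].
    by rewrite subrr /dot /= !mulr0 addr0.
  rewrite le_eqVlt => /predU1P[->|ut]; first by rewrite tE dotZr nTT mulr0.
  apply/eqP; rewrite eq_le support andbT leNgt; apply/negP => y0.
  have us : sigma s - sigma u = - (sigma u - sigma s) by rewrite opprB.
  have S0 : 0 < dot (nu (T u)) (sigma (s + L) - sigma u).
    rewrite sigma_per lt_def support andbT; apply: contraTneq y0 => us0.
    have := same_tangent us0; move: us0; rewrite us dotNr => /eqP.
    by rewrite oppr_eq0 => /eqP us0 ->; rewrite us0 ltxx.
  have uL : u < s + L < u + L by rewrite ltrD2r su (lt_trans ut).
  have utL : u <= t <= s + L by rewrite !ltW.
  have := chord_side uL utL S0; rewrite sigma_per leNgt => /negP; apply.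
  have -> : dot (nu (sigma s - sigma u)) (sigma t - sigma u) =
      d * dot (nu (T s)) (sigma u - sigma s).
    have -> : sigma t - sigma u = d *: T s - (sigma u - sigma s).
      by rewrite -tE opprB addrA subrK.
    rewrite us; move: (sigma u - _) => w.
    by rewrite /dot /= -![_ *: _]/(_ * _); ring.
  exact: mulr_gt0.
move=> u su_ut; split; first exact: flat.
have X0 : dot (T s) (sigma s - sigma s) = 0.
  by rewrite subrr /dot /= !mulr0 addr0.
have Xd : dot (T s) (sigma t - sigma s) = d by rewrite tE dotZr T_unit mulr1.
have not_crit m : s < m < t -> dot (T s) (T m) = 0 -> False.
  move=> /andP[sm mt] Tm0.
  have nTm0 : dot (nu (T s)) (T m) = 0.
    apply: (@dot_T_at_min _ (sigma s) s t); first by rewrite sm.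
    by move=> x _; rewrite flat ?support // !ltW.
  have := T_unit m; rewrite -[LHS]mul1r -(T_unit s) dot_frame Tm0 nTm0.
  by rewrite !mul0r addr0 T_unit => /esym/eqP; rewrite oner_eq0.
have Xc (e : R) :
    {within `[s, t], continuous (fun x => dot (e *: T s) (sigma x - sigma s))}.
  by apply: continuous_subspaceT; exact: continuous_dot_sub.
have dotZl (e : R) w : dot (e *: T s) w = e * dot (T s) w.
  by rewrite dotC dotZr dotC.
have bound (e : R) : e != 0 ->
    Num.min 0 (e * d) <= e * dot (T s) (sigma u - sigma s).
  move=> e0; have [m] := EVT_min (ltW st) (Xc e).
  rewrite in_itv /= => /andP[sm mt] m_min.
  rewrite -dotZl; apply: (le_trans _ (m_min u _)); last by rewrite in_itv.
  move: sm mt; rewrite le_eqVlt => /predU1P[<- _|sm].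
    by rewrite dotZl X0 mulr0 ge_min lexx.
  rewrite le_eqVlt => /predU1P[->|mt]; first by rewrite dotZl Xd ge_min lexx
    orbT.
  exfalso; apply: (not_crit m); first by rewrite sm.
  apply/eqP; rewrite -(mulrI_eq0 _ (mulfI e0)) -dotZl; apply/eqP.
  apply: (@dot_T_at_min _ (sigma s) s t); first by rewrite sm.
  by move=> x /andP[sx xt]; apply: m_min; rewrite in_itv /= !ltW.
apply/andP; split.
  by have := bound 1 (oner_neq0 _); rewrite !mul1r min_l // ltW.
have := bound (-1); rewrite oppr_eq0 oner_neq0 => /(_ isT).
by rewrite !mulN1r min_r ?oppr_le0 ?(ltW d0) // lerN2.
Qed.

(** The hypothesis [0 <= dot (nu (T s)) (T t)] says that the tangent turns by at
    most a half circle along the arc; the tangent lines at its ends then meet on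
    its side of the chord, and [slide_disk] applies in the direction [T s]. *)
Lemma arc_in_disk s t h rho (D := sigma t - sigma s)
    (c := chord_center (sigma s) (sigma t) h) :
  s < t < s + L -> 0 < dot (nu (T s)) D -> dot (nu (T t)) D < 0 ->
  0 <= dot (nu (T s)) (T t) -> 0 < rho -> rho * kappa < 1 ->
  rho ^+ 2 = dot D D * (4^-1 + h ^+ 2) ->
  forall u, s <= u <= t -> dot (sigma u - c) (sigma u - c) <= rho ^+ 2.
Proof.
move=> stL sD tD turn rho0 rk rhoE.
set v := T s.
have frame w : dot w w = dot v w ^+ 2 + dot (nu v) w ^+ 2.
  by rewrite -[LHS]mul1r -(T_unit s) dot_frame !expr2.
have tE : sigma t = sigma s + D by rewrite /D addrC subrK.
have on_chord (lam : R) : 0 <= lam <= 1 ->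
    dot (sigma s + lam *: D - c) (sigma s + lam *: D - c) <= rho ^+ 2.
  by rewrite rhoE; exact: chord_in_disk.
have end1 : dot (sigma s - c) (sigma s - c) <= rho ^+ 2.
  by have := on_chord 0; rewrite scale0r addr0 lexx ler01 => /(_ isT).
have end2 : dot (sigma t - c) (sigma t - c) <= rho ^+ 2.
  by have := on_chord 1; rewrite scale1r tE lexx ler01 => /(_ isT).
(* Along [v], every point of the arc lies above a point of the chord. *)
have foot u : s <= u <= t -> exists lam mu : R, [/\ 0 <= lam <= 1, 0 <= mu &
    sigma u = sigma s + lam *: D + mu *: v].
  move=> su_ut; have side := chord_side stL su_ut sD.
  have hi : dot (nu v) (sigma u - sigma s) <= dot (nu v) D.
    apply: (projects_onto_chord tD _ turn side); first exact: ltW.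
    by rewrite /D opprB addrA subrK support.
  have lo := support s u.
  pose lam := dot (nu v) (sigma u - sigma s) / dot (nu v) D.
  pose w := sigma u - (sigma s + lam *: D).
  have w0 : dot (nu v) w = 0.
    by rewrite /w opprD addrA dotBr dotZr /lam divfK ?subrr // gt_eqF.
  have wE : w = dot v w *: v.
    by rewrite [LHS](collinearE (T_neq0 s)) // T_unit divr1.
  have uE : sigma u = sigma s + lam *: D + dot v w *: v.
    by rewrite -wE /w addrC subrK.
  exists lam, (dot v w); split => //.
    by rewrite divr_ge0 ?(ltW sD) //= ler_pdivrMr // mul1r.
  rewrite -(pmulr_rge0 _ sD).
  have -> : dot (nu v) D * dot v w = - dot (nu D) (sigma u - sigma s).
    move: (dot v w) uE => mu ->.
    by rewrite /dot /= -![_ *: _]/(_ * _); ring.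
  by rewrite oppr_ge0.
move=> u su_ut.
have strip x : s <= x <= t -> `|dot (nu v) (sigma x - c)| <= rho.
  move=> /foot[lam [mu [lam01 mu0 ->]]].
  have -> : dot (nu v) (sigma s + lam *: D + mu *: v - c) =
      dot (nu v) (sigma s + lam *: D - c).
    by rewrite /dot /= -![_ *: _]/(_ * _); ring.
  rewrite -ler_sqr ?nnegrE ?(ltW rho0) // real_normK ?num_real //.
  by rewrite (le_trans _ (on_chord _ lam01)) // frame lerDr sqr_ge0.
have above := slide_disk kappa_gt0 sigmaD T_unit T_lip rho0 rk (T_unit s) strip
  end1 end2 su_ut.
have [lam [mu [lam01 mu0 uE]]] := foot _ su_ut.
have nE : dot (nu v) (sigma u - c) = dot (nu v) (sigma s + lam *: D - c).
  by rewrite uE /dot /= -![_ *: _]/(_ * _); ring.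
have vE : dot v (sigma u - c) = dot v (sigma s + lam *: D - c) + mu.
  rewrite uE -[X in _ = _ + X]mulr1 -(T_unit s) /v.
  by rewrite /dot /= -![_ *: _]/(_ * _); ring.
have := on_chord _ lam01; rewrite !frame nE -lerBrDr => low.
rewrite -lerBrDr.
set b := rho ^+ 2 - _ in low *.
have b0 : 0 <= b by rewrite (le_trans _ low) // sqr_ge0.
rewrite -ler_sqrt // sqrtr_sqr in low.
rewrite nE -/b in above.
rewrite -ler_sqrt // sqrtr_sqr ler_norml above andbT.
by move: low; rewrite ler_norml vE => /andP[low _];
  rewrite (le_trans low) // lerDl.
Qed.

Lemma arc_in_lens s t : s < t < s + L ->
  enorm (sigma t - sigma s) < 2 * kappa^-1 ->
  0 < dot (nu (T s)) (sigma t - sigma s) ->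
  dot (nu (T t)) (sigma t - sigma s) < 0 ->
  0 <= dot (nu (T s)) (T t) ->
  forall u, s <= u <= t -> lens kappa^-1 (sigma s) (sigma t) (sigma u).
Proof.
move=> stL dist sD tD turn u su_ut.
apply: lens_of_disks; first by rewrite invr_gt0.
- exact: sigma_inj.
- by rewrite -enorm_sqr ltr_sqr ?nnegrE ?enorm_ge0 // mulr_ge0 // invr_ge0 ltW.
- exact: chord_side stL su_ut sD.
- set D := sigma t - sigma s in dist sD tD *.
  move=> h h0 hr; pose rho := Num.sqrt (dot D D * (4^-1 + h ^+ 2)).
  have D0 : 0 < dot D D.
    by apply: dot_gt0; apply: contraTneq sD => ->;
      rewrite /dot /= !mulr0 addr0 ltxx.
  have rho2_gt0 : 0 < dot D D * (4^-1 + h ^+ 2).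
    by rewrite mulr_gt0 // ltr_wpDr ?sqr_ge0 // invr_gt0.
  have rho2 : rho ^+ 2 = dot D D * (4^-1 + h ^+ 2) by rewrite sqr_sqrtr // ltW.
  have rho0 : 0 < rho by rewrite sqrtr_gt0.
  rewrite -rho2; apply: arc_in_disk => //.
  rewrite -ltr_pdivlMr // div1r -ltr_sqr ?nnegrE ?(ltW rho0) ?rho2 //.
  by rewrite invr_ge0 ltW.
Qed.

Lemma flat_arc_in_lens s t : s < t < s + L ->
  enorm (sigma t - sigma s) < 2 * kappa^-1 ->
  dot (nu (T s)) (sigma t - sigma s) = 0 ->
  0 < dot (T s) (sigma t - sigma s) ->
  forall u, s <= u <= t -> lens kappa^-1 (sigma s) (sigma t) (sigma u).
Proof.
move=> stL dist nD0 d0 u su_ut.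
have along x : dot (nu (T s)) (sigma x - sigma s) = 0 ->
    sigma x - sigma s = dot (T s) (sigma x - sigma s) *: T s.
  by move=> nx; rewrite [LHS](collinearE (T_neq0 s)) // T_unit divr1.
have tE := along t nD0.
have [y0 /andP[X0 Xd]] := flat_arc stL d0 tE su_ut.
move: d0 tE X0 Xd; set d := dot _ (sigma t - _) => d0 tE X0 Xd.
pose l := dot (T s) (sigma u - sigma s) / d.
have uE : sigma u - sigma s = l *: (sigma t - sigma s).
  by rewrite [RHS](congr1 _ tE) scalerA divfK ?gt_eqF // -along.
have l01 : 0 <= l <= 1.
  by rewrite divr_ge0 ?(ltW d0) // ler_pdivrMr // mul1r.
apply: lens_of_disks; first by rewrite invr_gt0.
- exact: sigma_inj.
- by rewrite -enorm_sqr ltr_sqr ?nnegrE ?enorm_ge0 // mulr_ge0 // invr_ge0 ltW.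
- by rewrite uE dotZr dot_nu_self mulr0.
- move=> h _ _; have -> : sigma u = sigma s + l *: (sigma t - sigma s).
    by rewrite -uE addrC subrK.
  exact: chord_in_disk.
Qed.

(** The tangent turns by a full circle along the whole curve, hence by at most a
    half circle along one of the two arcs: the sign of
    [dot (nu (T s)) (T t)] is opposite for the two. *)
Lemma short_or_short s t : s < t < s + L ->
  enorm (sigma t - sigma s) < 2 * kappa^-1 ->
  (forall u, s <= u <= t -> lens kappa^-1 (sigma s) (sigma t) (sigma u)) \/
  (forall u, t <= u <= s + L -> lens kappa^-1 (sigma t) (sigma s) (sigma u)).
Proof.
move=> stL dist; have /andP[st tL] := stL.
have tsL : t < s + L < t + L by rewrite tL ltrD2r.
have tsE : sigma s - sigma t = - (sigma t - sigma s) by rewrite opprB.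
have dist' : enorm (sigma (s + L) - sigma t) < 2 * kappa^-1.
  by rewrite sigma_per tsE /enorm /= !sqrrN.
have [nD0|nDn0] := eqVneq (dot (nu (T s)) (sigma t - sigma s)) 0.
  have Tts := same_tangent nD0.
  have D_neq0 : sigma t - sigma s != 0 by rewrite subr_eq0 eq_sym sigma_inj.
  case: (ltgtP (dot (T s) (sigma t - sigma s)) 0) => Ds.
  - right; rewrite -[sigma s]sigma_per; apply: flat_arc_in_lens => //.
      by rewrite sigma_per Tts tsE dotNr nD0 oppr0.
    by rewrite sigma_per Tts tsE dotNr oppr_gt0.
  - by left; exact: flat_arc_in_lens.
  - have := dot_frame (T s) (sigma t - sigma s) (sigma t - sigma s).
    rewrite nD0 Ds !mul0r addr0 T_unit mul1r => /dot_eq0/eqP.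
    by rewrite (negPf D_neq0).
have sD : 0 < dot (nu (T s)) (sigma t - sigma s) by rewrite lt_def nDn0 support.
have tD : dot (nu (T t)) (sigma t - sigma s) < 0.
  have := support t s; rewrite tsE dotNr oppr_ge0 le_eqVlt => /predU1P[t0|//].
  have := @same_tangent t s; rewrite tsE dotNr t0 oppr0 => /(_ erefl) Tst.
  by move: sD; rewrite Tst t0 ltxx.
have [turn|turn] := lerP 0 (dot (nu (T s)) (T t)).
  by left; exact: arc_in_lens.
right; rewrite -[sigma s]sigma_per; apply: arc_in_lens => //.
- by rewrite sigma_per tsE dotNr oppr_gt0.
- by rewrite sigma_per T_per tsE dotNr oppr_lt0.
- by rewrite T_per dot_nul dotC oppr_ge0 -[dot _ _]dotC dotC ltW.
Qed.

End SupportedCurve.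

(** * The boundary curve of a convex region *)

Section ConvexRegion.
Variables (R : realType) (K : set (plane R)).
Hypotheses (K_open : open K) (K_convex : convex_set K).

Lemma convexE (a b : plane R) (l : R) : 0 <= l -> l <= 1 -> K a -> K b ->
  K (l *: a + (1 - l) *: b).
Proof.
move=> l0 l1 Ka Kb.
pose a' : convex_lmodType (plane R) := a.
have Ka' : a' \in K by rewrite inE.
by have := K_convex (Itv01 l0 l1) Ka' (mem_set Kb); rewrite inE.
Qed.

(** The point [q] can be replaced by a point of [K] so close to it that
    compensating at the other end moves [k] to a point still in [K]. *)
Lemma convex_open_segment (k q : plane R) (l : R) : 0 < l -> l <= 1 ->
  K k -> closure K q -> K (l *: k + (1 - l) *: q).
Proof.
move=> l0 l1 Kk Kq; set z := _ + _.
pose f (q' : plane R) := l^-1 *: (z - (1 - l) *: q').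
have fq : f q = k by rewrite /f /z addrK scalerA mulVf ?scale1r // gt_eqF.
have fc : continuous f.
  move=> x; apply: cvgZr; apply: cvgB; first exact: cvg_cst.
  by apply: cvgZr; exact: cvg_id.
have [q' [Kq' Kfq']] : K `&` (f @^-1` K) !=set0.
  by apply: Kq; apply: fc; rewrite fq; exact: open_nbhs_nbhs.
have -> : z = l *: f q' + (1 - l) *: q'.
  by rewrite /f scalerA mulfV ?gt_eqF // scale1r subrK.
by apply: convexE => //; exact: ltW.
Qed.

(** Were [k] on the tangent line, say ahead of [sigma t], then [sigma t] would
    lie strictly between a point of the curve just behind it and a point of [K]
    near [k], hence in [K]. *)
Lemma tangent_line_misses_convex (sigma : R -> plane R) (t : R)
    (T k : plane R) :
  is_derive t (1 : R) sigma T -> T != 0 ->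
  (forall s, closure K (sigma s)) -> ~ K (sigma t) -> K k ->
  dot (nu T) (k - sigma t) != 0.
Proof.
move=> sD T0 cK nK Kk; apply/eqP => k0; apply: nK.
pose lam := dot T (k - sigma t) / dot T T.
have kE : k = sigma t + lam *: T.
  by rewrite /lam -collinearE // addrC subrK.
(* [sigma t] divides the segment from the point of the curve of parameter
   [t - lam * h] to [back h] in the ratio [h] to [1]. *)
pose back (h : R) := sigma t - h^-1 *: (sigma (h *: - lam + t) - sigma t).
have back_cvg : back h @[h --> 0^'] --> k.
  have dt : differentiable sigma t by apply/derivable1_diffP; case: sD.
  have := @diff_derivable _ _ _ _ _ (- lam) dt.
  move=> /cvg_ex[l hl].
  have lE : l = - lam *: T.
    have <- : 'D_(- lam) sigma t = l by exact/cvg_lim.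
    by rewrite deriveE // deriv1E ?derive1E; case: sD => // ? <-.
  rewrite kE -[lam]opprK scaleNr; apply: cvgB; first exact: cvg_cst.
  by rewrite -lE; exact: hl.
have /back_cvg : nbhs k K by exact: open_nbhs_nbhs.
move=> /nbhs_ballP[e /= e0 he].
have h0 : 0 < e / 2 by rewrite divr_gt0.
have Kb : K (back (e / 2)).
  apply: he; last by rewrite gt_eqF.
  by rewrite /ball /= sub0r normrN gtr0_norm //; lra.
set h := e / 2 in h0 Kb.
pose l := h / (1 + h).
have h1 : 0 < 1 + h by lra.
have -> : sigma t = l *: back h + (1 - l) *: sigma (h *: - lam + t).
  rewrite /back; move: (sigma t) (sigma _) => p q.
  rewrite scalerBr scalerA.
  have -> : l * h^-1 = 1 - l by rewrite /l; field; rewrite !gt_eqF.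
  by rewrite scalerBr opprB addrA subrK -scalerDl addrC subrK scale1r.
apply: convex_open_segment => //; first by rewrite divr_gt0.
by rewrite ler_pdivrMr // mul1r lerDr.
Qed.

Lemma closure_half_plane (e c x : plane R) :
  (forall y, K y -> 0 <= dot e (y - c)) -> closure K x -> 0 <= dot e (x - c).
Proof.
move=> Ke Kx; rewrite leNgt; apply/negP => x_neg.
have fc : continuous (fun y : plane R => dot e (y - c)).
  move=> y; apply: continuous_cvg; first exact: continuous_dot.
  by apply: cvgB; [exact: cvg_id|exact: cvg_cst].
have [y [Ky]] : K `&` ((fun y => dot e (y - c)) @^-1` [set r | r < 0]) !=set0.
  by apply: Kx; apply: fc; exact: lt_nbhsl.
by rewrite /= ltNge Ke.
Qed.

(** If [K] lay on the left, the ray to the right of the curve would avoid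
    [K] and escape to infinity. *)
Lemma convex_right_of_tangent (sigma : R -> plane R) (t : R) (T k : plane R) :
  is_derive t (1 : R) sigma T -> T != 0 ->
  (forall s, closure K (sigma s)) -> ~ K (sigma t) ->
  (\forall h \near 0^'+, inside (range sigma) (sigma t + h *: nu T)) ->
  K k -> 0 < dot (nu T) (k - sigma t).
Proof.
move=> sD T0 cK nK ins Kk.
have off x : K x -> dot (nu T) (x - sigma t) != 0.
  exact: tangent_line_misses_convex.
rewrite lt_neqAle eq_sym off //= leNgt; apply/negP => k_neg.
have left x : K x -> dot (nu T) (x - sigma t) < 0.
  move=> Kx; rewrite ltNge; apply/negP => x_pos.
  set a := dot (nu T) (x - sigma t) in x_pos.
  set b := dot (nu T) (k - sigma t) in k_neg.
  have ab : 0 < a - b by lra.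
  pose l := - b / (a - b).
  have l0 : 0 <= l by rewrite divr_ge0 // ?oppr_ge0 ltW.
  have l1 : l <= 1 by rewrite ler_pdivrMr // mul1r; lra.
  have := off _ (convexE l0 l1 Kx Kk); rewrite (_ : dot _ _ = 0) ?eqxx //.
  have -> : l *: x + (1 - l) *: k - sigma t =
      l *: (x - sigma t) + (1 - l) *: (k - sigma t).
    by rewrite !scalerBr addrACA -opprD -scalerDl addrC [l + _]addrC subrK
      scale1r addrC.
  by rewrite dotDr !dotZr -/a -/b /l; field; rewrite gt_eqF.
have cleft x : closure K x -> dot (nu T) (x - sigma t) <= 0.
  move=> cx; rewrite -oppr_ge0 -dotNl; apply: closure_half_plane cx => y Ky.
  by rewrite dotNl oppr_ge0 ltW // left.
have [h h0 []] : exists2 h : R,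
    0 < h & inside (range sigma) (sigma t + h *: nu T).
  have [h [h1 h2]] := filter_ex (filterI ins (nbhs_right_gt (0 : R))).
  by exists h.
move=> _ bounded.
pose ray := [set sigma t + s *: nu T | s in [set s : R | 0 < s]].
have ray_out : ray `<=` ~` range sigma.
  move=> _ [s /= s0 <-] [u _ uE]; have := cleft _ (cK u); rewrite uE.
  rewrite addrAC subrr add0r dotZr dot_nu_nu leNgt => /negP; apply.
  by rewrite mulr_gt0 // dot_gt0.
have ray_conn : connected ray.
  apply: connected_continuous_connected.
    by apply/connected_intervalP => x y /= x0 y0 z /andP[xz _];
      exact: lt_le_trans xz.
  apply: continuous_subspaceT => s; apply: cvgD; first exact: cvg_cst.
  by apply: cvgZl; exact: cvg_id.
have ray_comp := connected_component_max (_ : ray (sigma t + h *: nu T))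
  ray_out ray_conn.
have {}ray_comp :
    ray `<=` connected_component (~` range sigma) (sigma t + h *: nu T).
  by apply: ray_comp; exists h.
have [M [M0 hM]] : exists M : R, 0 < M /\
    forall s, 0 < s -> `|sigma t + s *: nu T| <= M.
  have {}bounded : \forall M \near +oo, forall x,
      connected_component (~` range sigma) (sigma t + h *: nu T) x -> `|x| <= M.
    exact: bounded.
  have pos := nbhs_pinfty_gt (num_real (0 : R)).
  have [M [Mb M0]] := filter_ex (filterI bounded pos).
  by exists M; split => // s s0; apply: Mb; apply: ray_comp; exists s.
have nT0 : 0 < `|nu T|.
  rewrite normr_gt0; apply: contra_neq T0 => nT0; apply: dot_eq0.
  by rewrite -dot_nu_nu nT0 /dot /= !mulr0 addr0.
pose s := (M + `|sigma t| + 1) / `|nu T|.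
have s0 : 0 < s by rewrite divr_gt0 // ltr_wpDl // addr_ge0 // ltW.
have := hM s s0; have := ler_normB (sigma t + s *: nu T) (sigma t).
rewrite addrAC subrr add0r normrZ (gtr0_norm s0) divfK ?gt_eqF //; lra.
Qed.

End ConvexRegion.

(** * Parametrised loops *)

Section LoopFacts.
Variable R : realType.
Implicit Types (f : R -> R) (M L : R).

Definition lip_on M f (a b : R) :=
  forall x y, a <= x -> x <= y -> y <= b -> `|f y - f x| <= M * (y - x).

Lemma lip_on_cat M f (a b c : R) : lip_on M f a b -> lip_on M f b c ->
  lip_on M f a c.
Proof.
move=> ab bc x y ax xy yc.
have [yb|by_] := lerP y b; first exact: ab.
have [bx|xb] := lerP b x; first exact: bc.
have := bc b y (lexx b) (ltW by_) yc; have := ab x b ax (ltW xb) (lexx b).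
rewrite !ler_norml => /andP[? ?] /andP[? ?]; lra.
Qed.

Lemma lip_on_derive M f (df : R -> R) (a b : R) : 0 <= M -> continuous f ->
  (forall t, a < t < b -> is_derive t (1 : R) f (df t) /\ `|df t| <= M) ->
  lip_on M f a b.
Proof.
move=> M0 fc fd x y ax; rewrite le_eqVlt => /predU1P[->|xy] yb.
  by rewrite !subrr normr0 mulr0.
have in_ab t : t \in `]x, y[ -> a < t < b.
  by rewrite in_itv /= => /andP[xt ty]; rewrite (le_lt_trans ax xt)
    (lt_le_trans ty yb).
have [t txy ->] := MVT xy (fun t ht => (fd t (in_ab t ht)).1)
  (@continuous_subspaceT _ _ _ _ fc).
rewrite normrM [`|y - x|]gtr0_norm ?subr_gt0 //.
by rewrite ler_wpM2r ?subr_ge0 ?(ltW xy) ?(fd t (in_ab t txy)).2.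
Qed.

Lemma lip_on_periodic M L f : 0 < L -> (forall t, f (t + L) = f t) ->
  lip_on M f 0 L -> forall s t, `|f t - f s| <= M * `|t - s|.
Proof.
move=> L0 fL lip0.
have per n t : f (t + n%:R * L) = f t by rewrite mulr_natl; exact: periodicn.
have lip_n n : lip_on M f 0 (n%:R * L).
  elim: n => [|n IHn].
    move=> x y x0 xy; rewrite mul0r => y0.
    have -> : y = x by apply/eqP; rewrite eq_le xy (le_trans y0).
    by rewrite !subrr normr0 mulr0.
  apply: lip_on_cat IHn _ => x y nx xy yn.
  have := lip0 (x - n%:R * L) (y - n%:R * L).
  rewrite -(per n (x - _)) -(per n (y - _)) !subrK opprB addrA subrK; apply.
  - by rewrite subr_ge0.
  - by rewrite lerD2r.
  - by rewrite -natr1 mulrDl mul1r in yn; lra.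
have lip_le s t : s <= t -> `|f t - f s| <= M * (t - s).
  move=> st; pose m := (Num.trunc (- s / L)).+1.
  have sm : 0 <= s + m%:R * L.
    by have := truncnS_gt (- s / L); rewrite ltr_pdivrMr // -/m; lra.
  pose n := (Num.trunc ((t + m%:R * L) / L)).+1.
  have tn : t + m%:R * L <= n%:R * L.
    by have := truncnS_gt ((t + m%:R * L) / L);
      rewrite ltr_pdivrMr // -/n => /ltW.
  have := lip_n n (s + m%:R * L) (t + m%:R * L) sm.
  by rewrite lerD2r !per opprD addrACA subrr addr0 => /(_ st tn).
move=> s t; have [st|/ltW ts] := leP s t.
  by rewrite [`|t - s|]ger0_norm ?subr_ge0 ?lip_le.
by rewrite distrC [`|t - s|]distrC [`|s - t|]ger0_norm ?subr_ge0 ?lip_le.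
Qed.

Lemma periodic_inj (T : eqType) (L : R) (g : R -> T) : 0 < L ->
  (forall t, g (t + L) = g t) -> {in `[0, L[ &, injective g} ->
  forall s t, s < t < s + L -> g s != g t.
Proof.
move=> L0 gL ginj s t /andP[st tL].
have per n x : g (x + n%:R * L) = g x.
  elim: n => [|n IHn]; first by rewrite mul0r addr0.
  by rewrite -addn1 natrD mulrDl mul1r addrA gL.
have base x y : 0 <= x < L -> x < y < x + L -> g x != g y.
  move=> /andP[x0 xL] /andP[xy yx]; have [yL|Ly] := ltP y L.
    apply: contraTneq (xy) => /ginj ->; rewrite ?ltxx // in_itv /= ?x0 //.
    by rewrite yL andbT (le_trans x0) // ltW.
  rewrite -[g y](_ : g (y - L) = _); last by rewrite -gL subrK.
  have yLx : y - L < x by rewrite ltrBlDr.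
  apply: contraTneq (yLx) => /ginj ->; rewrite ?ltxx // in_itv /= ?x0 //.
  by rewrite subr_ge0 Ly /= (lt_trans yLx).
pose m := (Num.trunc (- s / L)).+1.
have sm : 0 <= s + m%:R * L.
  by have := truncnS_gt (- s / L); rewrite ltr_pdivrMr // -/m; lra.
pose n := Num.trunc ((s + m%:R * L) / L).
have /andP[n1 n2] := @truncn_itv _ ((s + m%:R * L) / L) (divr_ge0 sm (ltW L0)).
rewrite -/n ler_pdivlMr // in n1.
rewrite -/n ltr_pdivrMr // -natr1 mulrDl mul1r in n2.
rewrite -(per m s) -(per m t) -(subrK (n%:R * L) (s + _)).
rewrite -(subrK (n%:R * L) (t + _)) !per.
by apply: base; apply/andP; split; lra.
Qed.

Lemma derive1_periodic (V : normedModType R) (L : R) (g : R -> V) :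
  (forall t, g (t + L) = g t) -> forall t, derive1 g (t + L) = derive1 g t.
Proof.
move=> gL t; rewrite /derive1.
suff -> : (fun h => h^-1 *: (g (h + (t + L)) - g (t + L))) =
          (fun h => h^-1 *: (g (h + t) - g t)) by [].
by apply/funext => h; rewrite addrA !gL.
Qed.

(** The second derivative exists, and is bounded by [kappa], only inside each
    piece; the bounds on increments of [sigma'] add up across the break points
    and across the periods. *)
Lemma constrained_loop_lip (kappa L : R) (sigma : R -> plane R) :
  0 < kappa -> constrained_loop kappa L sigma ->
  forall e s t, `|dot e (derive1 sigma t - derive1 sigma s)|
                <= enorm e * kappa * `|t - s|.
Proof.
move=> k0 [[L0 per _ [_ Tc _] _] [n [a [a0 an pieces]]] curv] e s t.
pose f x := dot e (derive1 sigma x).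
have fL x : f (x + L) = f x by rewrite /f derive1_periodic.
have M0 : 0 <= enorm e * kappa by rewrite mulr_ge0 ?enorm_ge0 ?ltW.
have fc : continuous f.
  by move=> x; apply: continuous_cvg; [exact: continuous_dot|exact: Tc].
suff lip i : (i <= n)%N -> lip_on (enorm e * kappa) f 0 (a i).
  have lip0 : lip_on (enorm e * kappa) f 0 L by rewrite -an; exact: lip.
  by rewrite dotBr; exact: (lip_on_periodic L0 fL lip0 s t).
elim: i => [_|i IHi lt_in].
  rewrite a0 => x y x0 xy y0.
  have -> : y = x by apply/eqP; rewrite eq_le xy (le_trans y0).
  by rewrite !subrr normr0 mulr0.
apply: lip_on_cat (IHi (ltnW lt_in)) _.
have [_ [g gc gD]] := pieces i lt_in.
apply: (lip_on_derive (df := fun x => dot e (g x))) => // x /gD gx.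
split; first exact: is_derive_dot.
rewrite (le_trans (cauchy_schwarz _ _)) // ler_wpM2l ?enorm_ge0 //.
case: gx => gx <-; rewrite -derive1E; exact: curv.
Qed.

End LoopFacts.

Theorem theorem2p19 (R : realType) (kappa : R) (hkappa : 0 < kappa)
    (K : set (plane R)) (L : R) (sigma : R -> plane R)
    (hK : planar_domain K) (hsigma : constrained_loop kappa L sigma)
    (hboundary : boundary K = range sigma) :
  ((exists t1 t2, essential kappa^-1 L sigma t1 t2) -> ~ convex_set K) /\
  (convex_set K -> forall t1 t2, terminals L t1 t2 ->
     inessential kappa^-1 L sigma t1 t2).
Proof.
suff main : convex_set K -> forall t1 t2, ~ essential kappa^-1 L sigma t1 t2.
  split; first by move=> [t1 [t2 ess]] /main; apply; exact: ess.
  by move=> /main ness t1 t2 t12; split.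
move=> Kconv t1 t2 [t12 long1 long2].
have Kopen : open K by case: hK.
have lip := constrained_loop_lip hkappa hsigma.
case: hsigma => [[L0 per inj [sD _ T1] cw] _ _].
have on_boundary t : boundary K (sigma t) by rewrite hboundary; exists t.
have cK t : closure K (sigma t) by case: (on_boundary t).
have nK t : ~ K (sigma t).
  by case: (on_boundary t) => _; rewrite (iffLR (interior_id K)).
have sigmaD t : is_derive t (1 : R) sigma (derive1 sigma t).
  by apply: DeriveDef; rewrite ?derive1E.
have T_unit t : dot (derive1 sigma t) (derive1 sigma t) = 1.
  by rewrite -enorm_sqr T1 expr1n.
have T_neq0 := T_neq0 T_unit.
have right_side k t : K k -> 0 < dot (right_normal (derive1 sigma t)) (k -
  sigma t).
  exact: convex_right_of_tangent (cw t).
have [k0 [Kk0 _]] : K `&` setT !=set0 by apply: (cK 0); exact: filterT.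
have support s t : 0 <= dot (right_normal (derive1 sigma s)) (sigma t - sigma
  s).
  by apply: closure_half_plane (cK t) => k Kk; rewrite ltW // right_side.
have edistE a b : Defs.edist a b = enorm (b - a) :> R.
  by rewrite /Defs.edist -opprB /enorm /= !sqrrN.
have near : enorm (sigma t2 - sigma t1) < 2 * kappa^-1.
  by rewrite ltNge; apply/negP => far; apply: long1; right; left;
    rewrite edistE.
have := short_or_short hkappa sigmaD T_unit lip per (derive1_periodic per)
  (periodic_inj L0 per inj) support (right_side k0 ^~ Kk0) t12 near.
case=> [lens1|lens2].
  by apply: long1; left; left; rewrite edistE ltW.
apply: long2; left; left; rewrite per; split=> //.
by rewrite /Defs.edist ltW.
Qed.
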